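(* Let $\mathcal{L}(s)=p(s)/q(s)$ be a rational Laplace-Stieltjes transform of algebraic degree $n$ satisfying the standing assumptions of the context, with associated matrix $\mathcal{J}$, vector $\beta$ and constant $\xi$ as defined there. Then there exists an $n$-order continuous-time PH representation $(\alpha,A)$ of $\mathcal{L}(s)$, i.e. one such that $\mathcal{L}(s)=-\alpha A(sI-A)^{-1}\mathbf{1}^\top$, if and only if there exist real $n\times n$ matrices $P=(p_{ij})_{n\times n}$ and $A=(a_{ij})_{n\times n}$ such that $$PA=\mathcal{J}P;\qquad P\mathbf{1}^\top=\mathbf{1}^\top;\qquad \beta P\geq \mathbf{0};\qquad A\mathbf{1}^\top\leq \mathbf{0};$$ $$-\xi\leq a_{ii}\leq 0\ \text{ for } 1\leq i\leq n;\qquad 0\leq a_{ij}\leq \xi\ \text{ for } i\neq j,\ 1\leq i,j\leq n.$$ Moreover, any feasible solution $(A,P)$ of this system directly provides an $n$-order continuous-time PH representation $(\alpha,A)$ of $\mathcal{L}(s)$ with $\alpha=\beta P$.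
   Context: Vectors are row vectors; $\mathbf{1}$ is the all-ones vector, $\mathbf{0}$ the zero vector or matrix, $I$ the identity (sizes clear from context); inequalities between vectors are componentwise; $\imath$ is the imaginary unit. Standing assumptions. $F$ is a probability distribution on $[0,\infty)$ with continuous positive density on $(0,\infty)$, whose Laplace-Stieltjes transform is $$\mathcal{L}(s)=\int_{0-}^\infty e^{-st}\,dF(t)=\frac{p(s)}{q(s)}=\frac{p_{n-1}s^{n-1}+\cdots+p_0}{s^n+q_{n-1}s^{n-1}+\cdots+q_0},\quad \mathrm{Re}(s)\ge 0,$$ where (A1) the coefficients are real; (A2) $p$ and $q$ are coprime; (A3) $\mathcal{L}(0)=1$ and $\mathcal{L}$ has a unique pole of maximal real part. PH representation. An $n$-order continuous-time PH representation of $\mathcal{L}$ is a pair $(\alpha,A)$ with $\alpha\in\mathbb{R}^n$, $\alpha\ge\mathbf{0}$, $\alpha\mathbf{1}^\top=1$, and $A=(a_{ij})\in\mathbb{R}^{n\times n}$ nonsingular with $a_{ii}<0$ for all $i$, $a_{ij}\ge 0$ for $i\ne j$, $\sum_j a_{ij}\le 0$ for all $i$, such that $\mathcal{L}(s)=-\alpha A(sI-A)^{-1}\mathbf{1}^\top$. Poles. The distinct roots of $q$ are the real numbers $\lambda_1,\dots,\lambda_\ell$ and the conjugate pairs $\mu_j\pm\imath\omega_j$ ($\ell+1\le j\le k$, $\mu_j,\omega_j\in\mathbb{R}$, $\omega_j\neq0$), with multiplicities $n_1,\dots,n_k$, i.e. $q(s)=\prod_{i=1}^{\ell}(s-\lambda_i)^{n_i}\prod_{j=\ell+1}^{k}\big((s-\mu_j)^2+\omega_j^2\big)^{n_j}$.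 Matrix $\mathcal{J}$. $\mathcal{J}_m(\lambda)$ is the $m\times m$ matrix with $\lambda$ on the diagonal, $1$ on the first subdiagonal and $0$ elsewhere. $\mathcal{J}_m(\mu,\omega)$ is the $2m\times 2m$ matrix made of $2\times2$ blocks, with diagonal blocks $\Theta(\mu,\omega)=\begin{bmatrix}\mu&-\omega\\ \omega&\mu\end{bmatrix}$, first block-subdiagonal blocks equal to the $2\times 2$ identity, and zero elsewhere. Then $$\mathcal{J}=\mathrm{diag}\big(\mathcal{J}_{n_1}(\lambda_1),\dots,\mathcal{J}_{n_\ell}(\lambda_\ell),\mathcal{J}_{n_{\ell+1}}(\mu_{\ell+1},\omega_{\ell+1}),\dots,\mathcal{J}_{n_k}(\mu_k,\omega_k)\big)\in\mathbb{R}^{n\times n}.$$ Vector $\beta$. $\beta\in\mathbb{R}^n$ is the unique vector satisfying $\mathcal{L}(s)=-\beta\mathcal{J}(sI-\mathcal{J})^{-1}\mathbf{1}^\top$ identically in $s$. Constant $\xi$. $\xi=-\Big(\sum_{i=1}^\ell n_i\lambda_i+\sum_{j=\ell+1}^k 2n_j\mu_j\Big)$. *)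

(* Defs.v *)
From HB Require Import structures.
From mathcomp Require Import all_boot all_order all_algebra.
From mathcomp Require Import all_classical all_reals all_analysis.
From mathcomp Require Import complex.

Set Implicit Arguments.
Unset Strict Implicit.
Unset Printing Implicit Defensive.

Import Order.TTheory GRing.Theory Num.Theory.
Import numFieldNormedType.Exports.

Local Open Scope classical_set_scope.
Local Open Scope ring_scope.
Local Open Scope complex_scope.

Section Transforms.
Variable R : realType.

Definition cexp (z : R[i]) : R[i] :=
  (expR (complex.Re z) * cos (complex.Im z))
    +i* (expR (complex.Re z) * sin (complex.Im z)).

Definition Cintegral d (T : measurableType d) (mu : {measure set T -> \bar R})
    (D : set T) (f : T -> R[i]) : R[i] :=
  Rintegral mu D (fun t => complex.Re (f t))
    +i* Rintegral mu D (fun t => complex.Im (f t)).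

(* The domain is closed at 0: an atom of F at 0 is counted (the lower limit 0-). *)
Definition laplace_stieltjes (F : probability (measurableTypeR R) R)
    (s : R[i]) : R[i] :=
  Cintegral F [set` `[0, +oo[] (fun t : R => cexp (- (s * t%:C))).

(* The law itself may have an atom at 0, hence a density only on ]0, +oo[. *)
Definition has_continuous_positive_density
    (F : probability (measurableTypeR R) R) : Prop :=
  exists f : R -> R,
    (forall t, 0 < t -> {for t, continuous f} /\ 0 < f t) /\
    (forall B : set (measurableTypeR R), measurable B -> B `<=` [set` `]0, +oo[] ->
       F B = (\int[lebesgue_measure]_(t in B) (f t)%:E)%E).

Definition ceval (p : {poly R}) (s : R[i]) : R[i] :=
  (map_poly (real_complex R) p).[s].

(* The poles of p / q are the complex roots of q, because p and q are coprime. *)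
Record rational_LST (F : probability (measurableTypeR R) R) (n : nat)
    (p q : {poly R}) : Prop := RationalLST {
  lst_support : F [set` `]-oo, 0[] = 0%E;
  lst_density : has_continuous_positive_density F;
  lst_num : (size p <= n)%N;
  lst_den : size q = n.+1;
  lst_monic : q \is monic;
  lst_fraction : forall s : R[i], 0 <= complex.Re s ->
    ceval q s != 0 /\ laplace_stieltjes F s = ceval p s / ceval q s;
  lst_coprime : coprimep p q;
  lst_at0 : laplace_stieltjes F 0 = 1;
  lst_dominant_pole : exists z : R[i], ceval q z = 0 /\
    (forall w, ceval q w = 0 -> w != z -> complex.Re w < complex.Re z)
}.

Definition ones n : 'cV[R]_n := const_mx 1.

(* L(s) = - a A (s I - A)^-1 1 on the closed right half-plane, the domain of L.
   Invertibility is required since invmx is the identity on singular matrices. *)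
Definition represents (L : R[i] -> R[i]) n (a : 'rV[R]_n) (A : 'M[R]_n) : Prop :=
  forall s : R[i], 0 <= complex.Re s ->
    let toC m k (B : 'M[R]_(m, k)) := map_mx (real_complex R) B in
    (s%:M - toC n n A) \in unitmx /\
    L s = - (toC 1 n a *m toC n n A *m invmx (s%:M - toC n n A)
               *m toC n 1 (ones n)) 0 0.

Record PH_representation (L : R[i] -> R[i]) n (alpha : 'rV[R]_n)
    (A : 'M[R]_n) : Prop := PHRepresentation {
  ph_alpha_ge0 : forall i, 0 <= alpha 0 i;
  ph_alpha_sum : alpha *m ones n = 1%:M;
  ph_nonsingular : A \in unitmx;
  ph_diag : forall i, A i i < 0;
  ph_offdiag : forall i j, i != j -> 0 <= A i j;
  ph_rows : forall i, \sum_j A i j <= 0;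
  ph_transform : represents L alpha A
}.

End Transforms.

Section Jordan.
Variable R : realType.

Definition jordan_real m (lambda : R) : 'M[R]_m :=
  \matrix_(i, j) (if i == j then lambda else (i == j.+1 :> nat)%:R).

Definition Theta (mu omega : R) : 'M[R]_2 :=
  block_mx mu%:M (- omega)%:M omega%:M mu%:M : 'M[R]_(1 + 1).

(* The size \sum_(i < m) 2 is 2m, in the form imposed by \mxblock. *)
Definition jordan_complex m (mu omega : R) : 'M[R]_(\sum_(i < m) 2) :=
  \mxblock_(i < m, j < m)
    (if i == j then Theta mu omega
     else if i == j.+1 :> nat then 1%:M else 0 : 'M[R]_2).

(* The factorization of q over R, the j-th conjugate pair being
   pair_re j +/- i pair_im j; pair_im j has no prescribed sign, so pairs are
   distinguished by pair_re j and |pair_im j|. pole_dim follows from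
   pole_factorization when size q = n.+1, and gives Jmx the type 'M_n. *)
Record pole_data (n : nat) (q : {poly R}) := PoleData {
  nb_real : nat;
  nb_pairs : nat;
  real_pole : 'I_nb_real -> R;
  mult_real : 'I_nb_real -> nat;
  pair_re : 'I_nb_pairs -> R;
  pair_im : 'I_nb_pairs -> R;
  mult_pair : 'I_nb_pairs -> nat;
  real_pole_inj : injective real_pole;
  pair_im_neq0 : forall j, pair_im j != 0;
  pair_inj : forall j j',
    pair_re j = pair_re j' -> `|pair_im j| = `|pair_im j'| -> j = j';
  mult_real_gt0 : forall i, (0 < mult_real i)%N;
  mult_pair_gt0 : forall j, (0 < mult_pair j)%N;
  pole_factorization :
    q = (\prod_(i < nb_real) ('X - (real_pole i)%:P) ^+ mult_real i)
        * (\prod_(j < nb_pairs)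
             (('X - (pair_re j)%:P) ^+ 2 + (pair_im j ^+ 2)%:P) ^+ mult_pair j);
  pole_dim : (\sum_(i < nb_real) mult_real i
              + \sum_(j < nb_pairs) \sum_(k < mult_pair j) 2 = n)%N
}.

Variables (n : nat) (q : {poly R}) (D : pole_data n q).

Definition Jmx : 'M[R]_n :=
  castmx (pole_dim D, pole_dim D)
    (block_mx (\mxdiag_(i < nb_real D) jordan_real (mult_real i) (real_pole i)) 0
              0 (\mxdiag_(j < nb_pairs D)
                 jordan_complex (mult_pair j) (pair_re j) (pair_im j))).

Definition xi : R :=
  - (\sum_(i < nb_real D) (mult_real i)%:R * real_pole i
     + \sum_(j < nb_pairs D) 2 * (mult_pair j)%:R * pair_re j).

End Jordan.

Record feasible (R : realType) n (J : 'M[R]_n) (beta : 'rV[R]_n) (x : R)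
    (P A : 'M[R]_n) : Prop := Feasible {
  fs_intertwine : P *m A = J *m P;
  fs_ones : P *m ones R n = ones R n;
  fs_betaP : forall i, 0 <= (beta *m P) 0 i;
  fs_rows : forall i, (A *m ones R n) i 0 <= 0;
  fs_diag : forall i, - x <= A i i <= 0;
  fs_offdiag : forall i j, i != j -> 0 <= A i j <= x
}.

(* Main.v *)
(** A coprime fraction [p / q] of degree [n] makes every [n]-dimensional
    realization [u (x I - A)^-1 w] of it minimal: if [u] satisfied [u r(A) = 0]
    with [r != 0] of degree less than [n], then [r p / q] would be a polynomial
    and [q] would divide [r].  So the Krylov families [u A^i] and [A^j w] are
    bases, and they coincide up to a change of basis for any two realizations,
    because [u A^k w] can be read off the transform.  That change of basis is
    [P]; conversely [P A = J P] and [P 1 = 1] force [P] to be invertible.  The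
    entrywise bounds on [A] come from [tr A = tr J = - xi] and the signs of the
    entries and of the row sums of [A]. *)
Require Import Defs.
From HB Require Import structures.
From mathcomp Require Import all_boot all_order all_algebra.
From mathcomp Require Import all_classical all_reals all_analysis.
From mathcomp Require Import complex.
From mathcomp Require Import zify ring.

Local Open Scope ring_scope.

Import Order.TTheory GRing.Theory Num.Theory.

(** The naturals below [size (f - g)] would be too many roots for a nonzero [f - g]. *)
Lemma poly_eq_nonneg {R : realDomainType} (f g : {poly R}) :
  (forall x, 0 <= x -> f.[x] = g.[x]) -> f = g.
Proof.
move=> fg; apply/eqP; rewrite -subr_eq0; apply/negPn/negP => nz.
pose rs := [seq (i%:R : R) | i <- iota 0 (size (f - g))].
have rsP : all (root (f - g)) rs.
  by apply/allP => _ /mapP[i _ ->]; rewrite rootE hornerD hornerN fg ?subrr.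
have rsU : uniq rs.
  by rewrite map_inj_uniq ?iota_uniq// => i j /eqP; rewrite eqr_nat => /eqP.
by have := max_poly_roots nz rsP rsU; rewrite size_map size_iota ltnn.
Qed.

(** * Transfer functions, Krylov matrices and similarity of realizations *)

Section Resolvent.
Context {R : realFieldType} {n : nat}.
Implicit Types (A B : 'M[R]_n.+1) (u v : 'rV[R]_n.+1) (w z : 'cV[R]_n.+1).
Implicit Types (p q r g : {poly R}) (x : R).

(** The PH transform is the case [u = - (a *m A)], [w = 1], so its sign and its factor [A] are
    absorbed into [u]. *)
Definition transfer u A w x : R := (u *m invmx (x%:M - A) *m w) 0 0.

Lemma transfer_mulmx u A w x : x%:M - A \in unitmx ->
  transfer (u *m A) A w x = x * transfer u A w x - (u *m w) 0 0.
Proof.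
move=> xA; rewrite /transfer.
have -> : u *m A = x *: u - u *m (x%:M - A).
  by rewrite mulmxBr mul_mx_scalar opprB addrC subrK.
by rewrite !mulmxBl (mulmxK xA) -!scalemxAl !mxE.
Qed.

(** Exchanges the roles of [u] and [w], so that results on the rows [u A^i] also serve for the
    columns [A^j w]. *)
Lemma transfer_tr u A w x : transfer w^T A^T u^T x = transfer u A w x.
Proof.
rewrite /transfer; set M := u *m invmx (x%:M - A) *m w.
have -> : w^T *m invmx (x%:M - A^T) *m u^T = M^T.
  by rewrite /M !trmx_mul trmx_inv linearB /= tr_scalar_mx mulmxA.
by rewrite [LHS]mxE.
Qed.

(** Each factor [A] multiplies the transfer function by [x] up to a constant; [g] collects these
    constants along Horner's scheme. Its size matters when degrees are compared at infinity. *)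
Lemma transfer_horner A w r u : exists2 g : {poly R}, (size g <= (size r).-1)%N &
  forall x, x%:M - A \in unitmx ->
    transfer (u *m horner_mx A r) A w x = r.[x] * transfer u A w x - g.[x].
Proof.
move: u; elim/poly_ind: r => [u|r c IHr u].
  exists 0; first by rewrite size_poly0.
  by move=> x _; rewrite rmorph0 mulmx0 /transfer !mul0mx mxE !horner0 mul0r subr0.
have [g szg gP] := IHr (u *m A).
exists ((u *m w) 0 0 *: r + g).
  apply: leq_trans (size_polyD _ _) _; rewrite geq_max.
  have [r0|r0] := eqVneq r 0.
    by move: szg; rewrite r0 scaler0 size_poly0 leqn0 => /eqP->.
  have -> : size (r * 'X + c%:P) = (size r).+1.
    by rewrite size_MXaddC (negPf r0).
  by rewrite /= size_scale_leq (leq_trans szg) ?leq_pred.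
move=> x xA; rewrite mulrC rmorphD rmorphM /= horner_mx_X horner_mx_C mulmxDr.
have -> : transfer (u *m (A * horner_mx A r) + u *m c%:M) A w x =
    transfer (u *m A *m horner_mx A r) A w x + c * transfer u A w x.
  rewrite /transfer !mulmxDl mxE mulmxA mul_mx_scalar -!scalemxAl.
  by congr (_ + _); rewrite mxE.
rewrite gP // transfer_mulmx // !hornerE; ring.
Qed.

Definition krylov u A : 'M[R]_n.+1 := \matrix_i (u *m A ^+ i).

Lemma mul_krylov (c : 'rV[R]_n.+1) u A :
  c *m krylov u A = u *m horner_mx A (rVpoly c).
Proof.
rewrite mulmx_sum_row /rVpoly poly_def rmorph_sum mulmx_sumr.
apply: eq_bigr => i _ /=; rewrite rowK linearZ /= rmorphXn /= horner_mx_X.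
by rewrite -scalemxAr insubT //= => ltin; congr (c 0 _ *: _); apply/val_inj.
Qed.

Lemma krylov_unit p q u A w : coprimep p q -> size q = n.+2 ->
  (forall x, 0 <= x -> x%:M - A \in unitmx /\ q.[x] * transfer u A w x = p.[x]) ->
  krylov u A \in unitmx.
Proof.
move=> pq szq H; rewrite -row_free_unit -kermx_eq0; apply/eqP/row_matrixP => i.
rewrite row0; set c := row i _.
have cK : c *m krylov u A = 0.
  by apply/sub_kermxP; exact: row_sub.
(* A kernel vector is the coefficient list of a polynomial of size at most [n.+1] with
   [u r(A) = 0]. *)
pose r := rVpoly c.
have [g _ gP] := transfer_horner A w r u.
have rp : r * p = q * g.
  apply: poly_eq_nonneg => x /H[xA xp]; have := gP x xA.
  rewrite -mul_krylov cK /transfer !mul0mx mxE !hornerM -xp -/(transfer _ _ _ _).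
  by move=> /esym/eqP; rewrite subr_eq0 => /eqP <-; ring.
have qr : q %| r.
  by rewrite -(Gauss_dvdpl r (q := p)) 1?coprimep_sym // rp dvdp_mulr.
have r0 : r = 0.
  apply/eqP/negPn/negP => /dvdp_leq/(_ qr); rewrite szq ltnNge.
  by rewrite (leq_trans (size_poly _ _)).
by rewrite -[c]rVpolyK -/r r0 linear0.
Qed.

Lemma krylov_intertwine u A B (Q : 'M[R]_n.+1) : A *m Q = Q *m B ->
  krylov u A *m Q = krylov (u *m Q) B.
Proof.
move=> AQ; apply/row_matrixP => i; rewrite row_mul !rowK -!mulmxA; congr (_ *m _).
by elim: (i : nat) => [|k IH]; rewrite ?expr0 ?mul1mx ?mulmx1 // !exprSr -!mulmxE
  -mulmxA AQ !mulmxA IH.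
Qed.

(** For [B = A ^+ k] the entry is the moment of index [i + k + j], so the product is a Hankel matrix
    that depends on the moments only. *)
Lemma krylov_mul_entry u A (B : 'M[R]_n.+1) w i j :
  (krylov u A *m B *m (krylov w^T A^T)^T) i j =
    (u *m A ^+ i *m B *m A ^+ j *m w) 0 0.
Proof.
have trX k : (A^T ^+ k)^T = A ^+ k.
  elim: k => [|k IH]; first by rewrite !expr0 trmx1.
  by rewrite exprS exprSr -mulmxE trmx_mul trmxK IH.
transitivity ((row i (krylov u A) *m B *m col j (krylov w^T A^T)^T) 0 0).
  by rewrite -row_mul colE mulmxA -colE -row_mul !mxE.
by rewrite -tr_row !rowK trmx_mul trmxK trX !mulmxA.
Qed.

(** The number [u w] is the limit of [x * transfer u A w x] at infinity; a degree count recovers it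
    without limits. *)
Lemma transfer_eq_mulmx u A w v B z :
  (forall x, 0 <= x -> [/\ x%:M - A \in unitmx, x%:M - B \in unitmx &
     transfer u A w x = transfer v B z x]) ->
  (u *m w) 0 0 = (v *m z) 0 0 /\
  (forall x, 0 <= x -> transfer (u *m A) A w x = transfer (v *m B) B z x).
Proof.
move=> H.
suff uv : (u *m w) 0 0 = (v *m z) 0 0.
  by split=> // x /H[xA xB e]; rewrite !transfer_mulmx // e uv.
(* By Cayley-Hamilton the left side of [transfer_horner] vanishes, which leaves
   [transfer (u *m A) A w = f / char_poly A] with [f] of smaller degree. *)
have [f szf fP] := transfer_horner A w (char_poly A) (u *m A).
have [g szg gP] := transfer_horner B z (char_poly B) (v *m B).
rewrite Cayley_Hamilton mulmx0 in fP; rewrite Cayley_Hamilton mulmx0 in gP.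
rewrite size_char_poly /= in szf; rewrite size_char_poly /= in szg.
set d := (v *m z) 0 0 - (u *m w) 0 0.
(* [d] is a difference of strictly proper fractions, hence 0 by degrees. *)
have E : d *: (char_poly A * char_poly B) = f * char_poly B - char_poly A * g.
  apply: poly_eq_nonneg => x /[dup] x0 /H[xA xB e].
  have := fP _ xA; have := gP _ xB.
  rewrite /(transfer 0) !mul0mx mxE => /esym/eqP; rewrite subr_eq0 => /eqP eg.
  move=> /esym/eqP; rewrite subr_eq0 => /eqP ef.
  rewrite hornerD hornerN hornerZ !hornerM -ef -eg /d !transfer_mulmx // e; ring.
have cA := char_poly_monic A; have cB := char_poly_monic B.
have szE : (size (f * char_poly B - char_poly A * g)%R < (n.+2 + n.+2).-1)%N.
  apply: leq_ltn_trans (size_polyD _ _) _; rewrite size_polyN gtn_max.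
  apply/andP; split; apply: leq_ltn_trans (size_polyMleq _ _) _;
    by rewrite size_char_poly; move: (size f) (size g) szf szg => a b; lia.
have d0 : d = 0.
  apply/eqP/negPn/negP => dn0; move: szE; rewrite -E size_scale //.
  by rewrite size_monicM ?monic_neq0 // !size_char_poly ltnn.
by apply/esym/eqP; rewrite -subr_eq0 -/d d0.
Qed.

(** The moments are the coefficients of the expansion at infinity; passing from [u] to [u A] shifts
    them by one. *)
Lemma transfer_eq_moments u A w v B z :
  (forall x, 0 <= x -> [/\ x%:M - A \in unitmx, x%:M - B \in unitmx &
     transfer u A w x = transfer v B z x]) ->
  forall k, (u *m A ^+ k *m w) 0 0 = (v *m B ^+ k *m z) 0 0.
Proof.
move=> H k; elim: k u v H => [|k IHk] u v H.
  by rewrite !expr0 !mulmx1; have [] := transfer_eq_mulmx _ _ _ _ _ _ H.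
rewrite !exprS -!mulmxE !mulmxA; apply: IHk => x x0.
have [xA xB _] := H x x0; split=> //.
by have [_] := transfer_eq_mulmx _ _ _ _ _ _ H; apply.
Qed.

(** The state space isomorphism theorem. Equal moments give equal Hankel matrices, which factor
    through the Krylov matrices of either realization: shift 0 yields [P], shift 1 the
    intertwining. *)
Lemma minimal_realizations_similar p q u A w v B z :
  coprimep p q -> size q = n.+2 ->
  (forall x, 0 <= x -> x%:M - A \in unitmx /\ q.[x] * transfer u A w x = p.[x]) ->
  (forall x, 0 <= x -> x%:M - B \in unitmx /\ q.[x] * transfer v B z x = p.[x]) ->
  (forall x, 0 <= x -> q.[x] != 0) ->
  exists2 P : 'M[R]_n.+1, P \in unitmx &
    [/\ P *m A = B *m P, P *m w = z & v *m P = u].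
Proof.
move=> pq szq HA HB q0.
have HT C a b : (forall x, 0 <= x ->
     x%:M - C \in unitmx /\ q.[x] * transfer a C b x = p.[x]) ->
    krylov a C \in unitmx /\ krylov b^T C^T \in unitmx.
  move=> H; split; first exact: (krylov_unit p q a C b).
  apply: (krylov_unit p q b^T C^T a^T) => // x /H[xC <-].
  by rewrite transfer_tr -[x%:M]tr_scalar_mx -linearB /= unitmx_tr.
have [CA OA] := HT _ _ _ HA; have [CB OB] := HT _ _ _ HB.
have mom : forall k, (u *m A ^+ k *m w) 0 0 = (v *m B ^+ k *m z) 0 0.
  apply: transfer_eq_moments => x x0.
  have [xA eA] := HA x x0; have [xB eB] := HB x x0; split=> //.
  by apply: (mulfI (q0 x x0)); rewrite eA eB.
set cA := krylov u A in CA *; set cB := krylov v B in CB *.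
pose oA := (krylov w^T A^T)^T; pose oB := (krylov z^T B^T)^T.
have uoA : oA \in unitmx by rewrite unitmx_tr.
have hankel k : cA *m A ^+ k *m oA = cB *m B ^+ k *m oB.
  apply/matrixP => i j; rewrite !krylov_mul_entry.
  by have := mom (i + k + j)%N; rewrite !exprD -!mulmxE !mulmxA.
have h0 : cA *m oA = cB *m oB.
  by have := hankel 0; rewrite !expr0 !mulmx1.
have h1 : cA *m A *m oA = cB *m B *m oB by exact: (hankel 1).
pose P := oB *m invmx oA.
(* The form [oB *m invmx oA] gives [P w = z], this one gives [v P = u]; in both cases by reading row
   0, the starting vector of a Krylov matrix. *)
have PE : P = invmx cB *m cA.
  by rewrite /P -[oB](mulKmx CB) -h0 -!mulmxA mulmxV ?mulmx1.
exists P; first by rewrite PE unitmx_mul unitmx_inv CA CB.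
have PoA : P *m oA = oB by rewrite /P mulmxKV.
split.
- apply: (can_inj (mulmxK uoA)); rewrite -[RHS]mulmxA PoA PE -2!mulmxA.
  by rewrite [cA *m _]mulmxA h1 -mulmxA mulKmx.
- have := congr1 (fun M => (row 0 M^T)^T) PoA.
  by rewrite trmx_mul !trmxK row_mul !rowK !expr0 !mulmx1 trmx_mul !trmxK.
- have : cB *m P = cA by rewrite PE mulKVmx.
  by move/(congr1 (row 0)); rewrite row_mul !rowK !expr0 !mulmx1.
Qed.
End Resolvent.

(** Over an arbitrary field, because [represents] evaluates real matrices at complex [s]. *)
Lemma similar_transform {F : fieldType} {n : nat} (b : 'rV[F]_n)
    (A J P : 'M[F]_n) (w : 'cV[F]_n) (s : F) :
  P \in unitmx -> P *m A = J *m P -> s%:M - J \in unitmx ->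
  s%:M - A \in unitmx /\
  b *m P *m A *m invmx (s%:M - A) *m w = b *m J *m invmx (s%:M - J) *m (P *m w).
Proof.
move=> uP PA sJ.
have PsA : P *m (s%:M - A) = (s%:M - J) *m P.
  by rewrite mulmxBr mulmxBl PA mul_mx_scalar mul_scalar_mx.
have sA : s%:M - A \in unitmx.
  have : P *m (s%:M - A) \in unitmx by rewrite PsA unitmx_mul sJ uP.
  by rewrite unitmx_mul => /andP[].
split=> //; have PJ : P *m invmx (s%:M - A) = invmx (s%:M - J) *m P.
  by apply: (can_inj (mulmxK sA)); rewrite mulmxKV // -mulmxA PsA mulKmx.
by rewrite -(mulmxA b) PA !mulmxA -(mulmxA _ P) PJ !mulmxA.
Qed.

(** * The trace of [Jmx] *)

Lemma mxtrace_jordan_real {R : realType} (m : nat) (l : R) :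
  \tr (jordan_real m l) = m%:R * l.
Proof.
rewrite /mxtrace (eq_bigr (fun=> l)); last by move=> i _; rewrite mxE eqxx.
by rewrite sumr_const card_ord mulr_natl.
Qed.

Lemma mxtrace_jordan_complex {R : realType} (m : nat) (mu omega : R) :
  \tr (jordan_complex m mu omega) = 2 * m%:R * mu.
Proof.
rewrite mxtrace_mxblock (eq_bigr (fun=> mu *+ 2)).
  by rewrite sumr_const card_ord -mulr_natr -[mu *+ 2]mulr_natr; ring.
by move=> i _; rewrite eqxx (mxtrace_block (n1 := 1) (n2 := 1)) !mxtrace_scalar.
Qed.

Lemma mxtrace_Jmx {R : realType} (n : nat) (q : {poly R}) (D : pole_data n q) :
  \tr (Jmx D) = - xi D.
Proof.
have trcast k m (e : k = m) (M : 'M[R]_k) : \tr (castmx (e, e) M) = \tr M.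
  by case: m / e; rewrite castmx_id.
rewrite trcast mxtrace_block !mxtrace_mxdiag opprK; congr (_ + _);
  by apply: eq_bigr => i _; rewrite ?mxtrace_jordan_real ?mxtrace_jordan_complex.
Qed.

(** * From the transform to real realizations *)

Lemma rational_LST_gt0 {R : realType} (F : probability (measurableTypeR R) R)
    (n : nat) (p q : {poly R}) : rational_LST F n p q -> (0 < n)%N.
Proof.
move=> hL; case: n hL => // hL.
have [z [qz _]] := lst_dominant_pole hL.
have szq := lst_den hL.
(* In degree 0 a monic [q] has no root, hence no dominant pole. *)
have q1 : q = 1.
  have := lst_monic hL; rewrite monicE lead_coefE szq /= => /eqP q0.
  by rewrite [q]size1_polyC ?szq // q0.
by move: qz; rewrite q1 /ceval rmorph1 hornerE => /eqP; rewrite oner_eq0.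
Qed.

(** On the half-line [x >= 0] every term is real, and the identity descends along the injection of
    [R] into [R[i]]. *)
Lemma represents_real {R : realType} (F : probability (measurableTypeR R) R)
    (n : nat) (p q : {poly R}) (a : 'rV[R]_n.+1) (A : 'M[R]_n.+1) :
  rational_LST F n.+1 p q -> represents (laplace_stieltjes F) a A ->
  forall x, 0 <= x -> [/\ q.[x] != 0, x%:M - A \in unitmx &
    q.[x] * transfer (- (a *m A)) A (ones R n.+1) x = p.[x]].
Proof.
move=> hL hA x x0.
have xE : (x%:C)%C%:M - map_mx (real_complex R) A =
    map_mx (real_complex R) (x%:M - A) by rewrite map_mxB map_scalar_mx.
have evE r : ceval r x%:C%C = (r.[x])%:C%C by rewrite /ceval horner_map.
have [qx LE] := lst_fraction hL (s := (x%:C)%C) x0.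
have [] := hA (x%:C)%C x0; rewrite /= xE map_unitmx => xA.
rewrite -map_invmx -!map_mxM LE !evE mxE => e.
rewrite evE in qx; have q0 : q.[x] != 0 by apply: contra qx => /eqP ->.
split=> //; rewrite /transfer !mulNmx mxE.
have e' : p.[x] / q.[x] = - (a *m A *m invmx (x%:M - A) *m ones R n.+1) 0 0.
  by apply: (@complexI R); rewrite rmorphM fmorphV rmorphN.
by rewrite -e' mulrCA divff ?mulr1.
Qed.

(** * The feasibility criterion *)

Theorem theorem1 (R : realType) (F : probability (measurableTypeR R) R)
    (n : nat) (p q : {poly R}) (hL : rational_LST F n p q)
    (D : pole_data n q) (beta : 'rV[R]_n)
    (hbeta : represents (laplace_stieltjes F) beta (Jmx D)) :
  ((exists (alpha : 'rV[R]_n) (A : 'M[R]_n),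
      PH_representation (laplace_stieltjes F) alpha A)
   <->
   (exists P A : 'M[R]_n, feasible (Jmx D) beta (xi D) P A))
  /\
  (forall P A : 'M[R]_n, feasible (Jmx D) beta (xi D) P A ->
     PH_representation (laplace_stieltjes F) (beta *m P) A).
Proof.
case: n p q hL D beta hbeta => [|n] p q hL.
  by have := rational_LST_gt0 _ _ _ _ hL.
move=> D beta hbeta.
have HL := represents_real _ _ _ _ _ _ hL.
have HJ := HL _ _ hbeta.
have cpq := lst_coprime hL; have szq := lst_den hL.
set J := Jmx D in hbeta HJ *.
have Jinv : J \in unitmx.
  by have [_] := HJ 0 (lexx 0); rewrite raddf0 sub0r -scaleN1r unitmxZ ?unitrN1.
(* At [s = 0] the resolvent cancels [J], so the formula for the transform collapses to [beta 1], and
   its value there is 1. *)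
have beta1 : (beta *m ones R n.+1) 0 0 = 1.
  have [q0 J0 e] := HJ 0 (lexx 0).
  have [_] := lst_fraction hL (s := 0) (lexx 0).
  have ev0 r : ceval r 0 = (r.[0])%:C%C by rewrite /ceval -horner_map rmorph0.
  rewrite (lst_at0 hL) !ev0 -fmorphV -rmorphM => /(@complexI R).
  rewrite -e mulrAC divff // mul1r => ->.
  rewrite /transfer (_ : - (beta *m J) = beta *m (0%:M - J)) ?mulmxK //.
  by rewrite raddf0 sub0r mulmxN.
have feasPH P A : feasible J beta (xi D) P A ->
  PH_representation (laplace_stieltjes F) (beta *m P) A.
  move=> H; have PA := fs_intertwine H.
  have P1 := fs_ones H.
  have uP : P \in unitmx.
    (* The vectors [J^j 1] form a basis; as [1 = P 1] and [J P = P A], they equal [P A^j 1], so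
       [P^T] is a factor of an invertible matrix. *)
    have KJ : krylov (ones R n.+1)^T J^T \in unitmx.
      apply: (krylov_unit p q _ _ (- (beta *m J))^T) => // x /HJ[_ xJ <-].
      by rewrite transfer_tr -[x%:M]tr_scalar_mx -linearB /= unitmx_tr.
    move: KJ; rewrite -P1 trmx_mul -(krylov_intertwine _ A^T); last first.
      by rewrite -!trmx_mul PA.
    by rewrite unitmx_mul unitmx_tr => /andP[].
  have uA : A \in unitmx.
    have : P *m A \in unitmx by rewrite PA unitmx_mul Jinv uP.
    by rewrite unitmx_mul => /andP[].
  have rowsum i : \sum_j A i j <= 0.
    have := fs_rows H i; rewrite mxE; congr (_ <= 0).
    by apply: eq_bigr => j _; rewrite mxE mulr1.
  split=> //.
  - exact: fs_betaP H.
  - rewrite -mulmxA P1; apply/matrixP => i j; rewrite !ord1 [RHS]mxE eqxx /=.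
    exact: beta1.
  - move=> i; rewrite lt_neqAle; have /andP[_ ->] := fs_diag H i; rewrite andbT.
    (* A zero diagonal entry would leave a nonnegative row with sum at most 0, hence a zero row in
       the invertible [A]. *)
    apply/eqP => Aii.
    have nonneg j : 0 <= A i j.
      have [<-|ij] := eqVneq i j; first by rewrite Aii.
      by have /andP[] := fs_offdiag H ij.
    have Ai0 : row i A = 0.
      apply/rowP => j; rewrite !mxE; apply/eqP; rewrite eq_le nonneg andbT.
      apply: le_trans (rowsum i); rewrite (bigD1 j) //= lerDl.
      by apply: sumr_ge0 => k _; exact: nonneg.
    have : delta_mx 0 i *m A = 0 :> 'rV[R]_n.+1 by rewrite -rowE.
    move/(congr1 (mulmx^~ (invmx A))); rewrite mulmxK // mul0mx.
    by move/rowP/(_ i)/eqP; rewrite !mxE !eqxx oner_eq0.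
  - by move=> i j ij; have /andP[] := fs_offdiag H ij.
  - move=> s s0 /=; have [sJ ->] := hbeta s s0.
    have PAC : map_mx (real_complex R) P *m map_mx (real_complex R) A =
        map_mx (real_complex R) J *m map_mx (real_complex R) P.
      by rewrite -!map_mxM PA.
    have uPC : map_mx (real_complex R) P \in unitmx by rewrite map_unitmx.
    have [sA e] := similar_transform (map_mx (real_complex R) beta) _ _ _
      (map_mx (real_complex R) (ones R n.+1)) s uPC PAC sJ.
    by split=> //; rewrite map_mxM e -(map_mxM _ P) P1.
split; last exact: feasPH.
split; last by move=> [P [A H]]; exists (beta *m P), A; exact: feasPH.
move=> [alpha [A H]].
have HA := HL _ _ (ph_transform H); have uA := ph_nonsingular H.
have [P uP [PA P1 bP]] : exists2 P : 'M[R]_n.+1, P \in unitmx &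
    [/\ P *m A = J *m P, P *m ones R n.+1 = ones R n.+1 &
        - (beta *m J) *m P = - (alpha *m A)].
  apply: (minimal_realizations_similar p q) => // x.
  - by case/HA.
  - by case/HJ.
  - by case/HJ.
(* The similarity relates [beta J] to [alpha A]; intertwining turns [beta J P] into [beta P A], and
   [A] cancels. *)
have bPa : beta *m P = alpha.
  apply: (can_inj (mulmxK uA)); apply: oppr_inj.
  by rewrite -bP mulNmx -!mulmxA PA.
have trA : \tr A = - xi D.
  by rewrite -mxtrace_Jmx -/J -(mulKmx uP A) PA mxtrace_mulC mulmxK.
(* The other diagonal entries are negative, so each one is at least the trace. *)
have diag_ge i : - xi D <= A i i.
  rewrite -trA /mxtrace (bigD1 i) //= gerDl.
  by apply: sumr_le0 => j _; apply/ltW/(ph_diag H).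
exists P, A; split=> //.
- by move=> i; rewrite bPa; exact: ph_alpha_ge0 H i.
- move=> i; rewrite mxE; have := ph_rows H i; congr (_ <= 0).
  by apply: eq_bigr => j _; rewrite mxE mulr1.
- by move=> i; rewrite diag_ge ltW ?(ph_diag H).
move=> i j ij; rewrite (ph_offdiag H) //=.
(* Dropping the other nonnegative entries from the row sum leaves [A i i + A i j <= 0], so
   [A i j <= - A i i <= xi]. *)
rewrite -[xi D]opprK lerNr; apply: le_trans (diag_ge i) _.
rewrite -subr_le0 opprK; apply: le_trans (ph_rows H i).
rewrite (bigD1 i) //= (bigD1 j) 1?eq_sym //= addrA lerDl.
by apply: sumr_ge0 => k /andP[ki _]; rewrite (ph_offdiag H) // eq_sym.
Qed.
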